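(* Let $k$ be an integer with $1\le k\le n-1$, let $f$ be a positive smooth function on $\mathbb{S}^{n-1}$, and let $p,q\in\mathbb{R}$ with $q<p$. Then the solution to the equation $$\frac{h^{1-p}}{(h^2+|\nabla h|^2)^{\frac{n-q}{2}}}\,\sigma_k(\nabla_{ij}h+h\delta_{ij})=f\quad\text{on }\mathbb{S}^{n-1}$$ is unique; that is, if $h_1$ and $h_2$ are two solutions, then $h_1\equiv h_2$.
   Context: $\nabla$ is the gradient on $\mathbb{S}^{n-1}$ and $\nabla_{ij}h$ the Hessian of $h$ with respect to a local orthonormal frame on $\mathbb{S}^{n-1}$; $\sigma_k$ of a symmetric $(n-1)\times(n-1)$ matrix is the $k$-th elementary symmetric function of its eigenvalues. A solution is a smooth function $h:\mathbb{S}^{n-1}\to(0,\infty)$ satisfying the equation which is the support function of a smooth, closed, strictly convex hypersurface containing the origin in its interior, so that the matrix $\nabla_{ij}h+h\delta_{ij}$ is positive definite. *)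

(* Defs.v *)
From mathcomp Require Import all_boot all_order all_algebra.
From mathcomp Require Import all_classical all_reals all_analysis.

Set Implicit Arguments.
Unset Strict Implicit.
Unset Printing Implicit Defensive.

Import Order.TTheory GRing.Theory Num.Theory.
Import numFieldNormedType.Exports.

Local Open Scope classical_set_scope.
Local Open Scope ring_scope.

Section Euclidean.
Context {R : realType} {n : nat}.
Implicit Types (x y v w : 'rV[R]_n) (F : 'rV[R]_n -> R).

Definition dot v w : R := (v *m w^T) 0 0.

(* The library norm [`|x|] on row vectors is the sup norm; it only serves to
   give the topology. *)
Definition enorm x : R := Num.sqrt (dot x x).

Definition sphere : set 'rV[R]_n := [set x | dot x x = 1].

Definition partials F x : 'rV[R]_n := \row_j 'D_(delta_mx 0 j) F x.

Definition iter_deriv (vs : seq 'rV[R]_n) F : 'rV[R]_n -> R :=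
  foldr (fun v G => fun x => 'D_v G x) F vs.

(* C^oo on the open set U: all iterated directional derivatives of F are
   Frechet differentiable at every point of U. *)
Definition smooth_on (U : set 'rV[R]_n) F : Prop :=
  forall (vs : seq 'rV[R]_n) x, U x -> differentiable (iter_deriv vs F) x.

(* Functions on the sphere are represented by functions on R^n, of which only
   the values on the sphere are used: every notion below about such a function
   goes through its radial extension y |-> F (y / |y|). *)
Definition radial {T : Type} (F : 'rV[R]_n -> T) : 'rV[R]_n -> T :=
  fun y => F ((enorm y)^-1 *: y).

(* y |-> y / |y| is a smooth submersion of R^n \ {0} onto the sphere, so this
   is smoothness of F as a function on the manifold S^(n-1). *)
Definition smooth_sphere F : Prop := smooth_on [set y | y != 0] (radial F).

(* The radial derivative of [radial F] vanishes, so for x on the sphere this is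
   the tangent vector with <grad F x, v> = dF_x(v) for all v tangent at x. *)
Definition sgrad F x : 'rV[R]_n := partials (radial F) x.

(* Covariant Hessian <nabla_v grad F, w> at x, for v and w tangent at x.  The
   Levi-Civita connection of the sphere is the tangential part of the ambient
   derivative; pairing with the tangent vector w discards the normal part. *)
Definition shess F x v w : R := dot ('D_v (radial (sgrad F)) x) w.

(* The rows of E form an orthonormal basis of the tangent space at x. *)
Definition tangent_frame x (E : 'M[R]_(n.-1, n)) : Prop :=
  E *m E^T = 1%:M /\ E *m x^T = 0.

(* (nabla_ij F + F delta_ij) at x in the frame E *)
Definition hess_mx F x (E : 'M[R]_(n.-1, n)) : 'M[R]_n.-1 :=
  (\matrix_(i, j) shess F x (row i E) (row j E)) + (F x)%:M.

Definition strictly_convex (K : set 'rV[R]_n) : Prop :=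
  forall y z (t : R), K y -> K z -> y <> z -> 0 < t < 1 ->
    interior K (t *: y + (1 - t) *: z).

Definition boundary (K : set 'rV[R]_n) : set 'rV[R]_n := closure K `\` interior K.

Definition smooth_hypersurface (M : set 'rV[R]_n) : Prop :=
  forall y, M y -> exists (U : set 'rV[R]_n) F,
    [/\ open U, U y, smooth_on U F,
        forall z, U z -> partials F z <> 0 &
        forall z, U z -> (M z <-> F z = 0)].

(* M is a smooth closed strictly convex hypersurface with the origin in the
   interior of the body it bounds. *)
Definition convex_hypersurface (M : set 'rV[R]_n) : Prop :=
  smooth_hypersurface M /\
  exists K : set 'rV[R]_n,
    [/\ compact K, strictly_convex K, interior K 0 & M = boundary K].

Definition support_function_of (M : set 'rV[R]_n) F : Prop :=
  forall x, sphere x -> F x = sup [set dot x y | y in M].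

End Euclidean.

Section SymmetricFunctions.
Context {R : realType} {m : nat}.
Implicit Types A : 'M[R]_m.

Definition esym (k : nat) (lam : 'rV[R]_m) : R :=
  \sum_(I : {set 'I_m} | #|I| == k) \prod_(i in I) lam 0 i.

(* The eigenvalues of A with multiplicity, in an arbitrary order; they exist
   in R whenever A is symmetric. *)
Definition eigenvalues A : 'rV[R]_m :=
  xget 0 [set lam : 'rV[R]_m |
            char_poly A = \prod_(i < m) ('X - (lam 0 i)%:P)].

Definition sigma (k : nat) A : R := esym k (eigenvalues A).

Definition posdef A : Prop :=
  forall v : 'rV[R]_m, v <> 0 -> 0 < (v *m A *m v^T) 0 0.

End SymmetricFunctions.

Definition is_solution {R : realType} (n k : nat) (p q : R)
    (f h : 'rV[R]_n -> R) : Prop :=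
  [/\ smooth_sphere h,
      forall x, sphere x -> 0 < h x,
      exists M : set 'rV[R]_n, convex_hypersurface M /\ support_function_of M h,
      forall x (E : 'M[R]_(n.-1, n)), sphere x -> tangent_frame x E ->
        posdef (hess_mx h x E) &
      forall x (E : 'M[R]_(n.-1, n)), sphere x -> tangent_frame x E ->
        (h x) `^ (1 - p)
          / (h x ^+ 2 + enorm (sgrad h x) ^+ 2) `^ ((n%:R - q) / 2)
          * sigma k (hess_mx h x E) = f x].

(* Main.v *)
Require Import Defs.
From mathcomp Require Import all_boot all_order all_algebra.
From mathcomp Require Import all_classical all_reals all_analysis.
From mathcomp Require Import spectral complex ring lra.
Import Order.TTheory GRing.Theory Num.Theory.
Import numFieldNormedType.Exports.
Local Open Scope classical_set_scope.
Local Open Scope ring_scope.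

(** Let c be the maximum of h1 / h2 on the sphere, attained at y.  Then
    h1 - c h2 has a maximum with value 0 at y, so there h1 = c h2, the gradients
    of h1 and c h2 agree, and the matrix nabla^2 h1 + h1 I is bounded by c times
    that of h2 in the Loewner order.  As sigma_k is monotone on positive
    semidefinite matrices, the left-hand side of the equation for h1 at y is at
    most c^(1 - p - (n - q) + k) times the one for h2.  Both equal f(y) > 0 and
    the exponent is negative because k <= n - 1 and q < p, so c <= 1, that is
    h1 <= h2; exchange h1 and h2. *)

(** * Monotonicity of sigma_k *)

Lemma char_poly_conj (K : comUnitRingType) n (P A : 'M[K]_n) :
  P \in unitmx -> char_poly (invmx P *m A *m P) = char_poly A.
Proof.
move=> Pu; rewrite /char_poly /char_poly_mx.
have -> : 'X%:M - map_mx polyC (invmx P *m A *m P) =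
   map_mx polyC (invmx P) *m ('X%:M - map_mx polyC A) *m map_mx polyC P.
  rewrite mulmxBr mulmxBl !map_mxM scalar_mxC -[X in _ = X - _]mulmxA.
  rewrite -(map_mxM polyC (invmx P) P).
  by rewrite mulVmx// map_mx1 mulmx1.
rewrite !det_mulmx mulrAC -det_mulmx -map_mxM mulVmx// map_mx1 det1.
by rewrite mul1r.
Qed.

Lemma char_poly_oppconj (K : comUnitRingType) n (P A : 'M[K]_n) :
  P \in unitmx -> char_poly (- (invmx P *m A *m P)) = char_poly (- A).
Proof. by move=> Pu; rewrite -mulNmx -mulmxN char_poly_conj. Qed.

Lemma coef_comp_polyZX (K : comNzRingType) (p : {poly K}) (c : K) i :
  (p \Po (c *: 'X))`_i = c ^+ i * p`_i.
Proof.
rewrite coef_comp_poly.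
under eq_bigr do rewrite exprZn coefZ coefXn.
case: (ltnP i (size p)) => hi.
  rewrite (bigD1 (Ordinal hi))//= eqxx mulr1 mulrC big1 ?addr0// => j.
  by rewrite -val_eqE/= eq_sym => /negbTE ->; rewrite !mulr0.
rewrite [in RHS]nth_default// mulr0 big1// => j _.
by rewrite gtn_eqF ?mulr0//; apply: leq_trans hi.
Qed.

(* Both sides are the coefficient of X^i in det (c X - c A). *)
Lemma coef_char_polyZ (K : comNzRingType) n (A : 'M[K]_n) (c : K) i :
  c ^+ i * (char_poly (c *: A))`_i = c ^+ n * (char_poly A)`_i.
Proof.
rewrite -coef_comp_polyZX -coefZ; congr (_`_i).
rewrite /char_poly -(det_map_mx (comp_poly (c *: 'X))) -mul_polyC rmorphXn/=.
rewrite -detZ.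
suff -> : map_mx (comp_poly (c *: 'X)) (char_poly_mx (c *: A)) =
  c%:P *: char_poly_mx A by [].

apply/matrixP => a b; rewrite !mxE.
rewrite !rmorphB/= rmorphMn/= comp_polyX comp_polyC mulrBr mulrnAr.
by rewrite mul_polyC polyCM.
Qed.

(** The perturbation touches only row i, and the determinant is affine in that row. Row i changes by
    a multiple of the i-th unit vector, and expansion along that vector leaves the principal
    minor. *)
Lemma char_poly_add_delta (K : comNzRingType) n (A : 'M[K]_n) i d :
  char_poly (- (A + d *: delta_mx i i)) =
  char_poly (- A) + d *: char_poly (- row' i (col' i A)).
Proof.
pose B := char_poly_mx (- A).
pose E : 'M[{poly K}]_n :=
  \matrix_(a, b) (if a == i then (b == i)%:R else B a b).
rewrite /char_poly (@determinant_multilinear _ _ _ B E i 1 d%:P).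
- rewrite mul1r mul_polyC; congr (_ + d *: _).
  rewrite (expand_det_row E i) (bigD1 i)//= big1 => [|j ji].
    rewrite mxE !eqxx mul1r addr0 /cofactor addnn -signr_odd odd_double mul1r.
    apply: (congr1 determinant); apply/matrixP => a b.
    rewrite !mxE eq_sym (negbTE (neq_lift _ _)).
    by rewrite (inj_eq (@lift_inj _ i)).
  by rewrite mxE eqxx (negbTE ji) mul0r.
- apply/rowP => b; rewrite !mxE eqxx/= !rmorphN/= rmorphD/= eq_sym.
  case: eqP => [->|_]; rewrite ?eqxx/= ?mulr1 ?mulr0 ?polyC0.
    by rewrite mul1r !opprK addrA.
  by rewrite !addr0 mul1r.
- apply/matrixP => a b.
  rewrite !mxE [lift i a == i]eq_sym (negbTE (neq_lift _ _))/=.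
  by rewrite mulr0 addr0.
- apply/matrixP => a b.
  rewrite !mxE [lift i a == i]eq_sym (negbTE (neq_lift _ _))/=.
  by rewrite mulr0 addr0.
Qed.

Lemma coef_prod_XaddC_ge0 (K : numDomainType) n (lam : 'I_n -> K) i :
  (forall j, 0 <= lam j) -> 0 <= (\prod_j ('X + (lam j)%:P))`_i.
Proof.
move=> lam0; elim/big_ind: _ i => [i|p q p0 q0 i|j _ i].
- by rewrite coef1 ler0n.
- by rewrite coefM sumr_ge0// => j _; rewrite mulr_ge0.
- by rewrite coefD coefX coefC addr_ge0 ?ler0n//; case: ifP.
Qed.

Lemma char_poly_opp_diag (K : comNzRingType) n (D : 'rV[K]_n) :
  char_poly (- diag_mx D) = \prod_i ('X + (D 0 i)%:P).
Proof.
have -> : - diag_mx D = diag_mx (- D) by rewrite linearN.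
rewrite char_poly_trig ?diag_mx_is_trig//; apply: eq_bigr => i _.
by rewrite !mxE eqxx mulr1n polyCN opprK.
Qed.

(** * Loewner monotonicity for complex Hermitian matrices *)

Section Hermitian.
Local Open Scope sesquilinear_scope.
Context {C : numClosedFieldType}.

(** Stated over a closed field so that unitary diagonalisation applies; real matrices enter by
    complexification. *)
Definition psdmx {n} (A : 'M[C]_n) : Prop :=
  A ^t* = A /\ forall v : 'rV_n, 0 <= (v *m A *m v ^t*) 0 0.

Lemma psdmx_conj m n (M : 'M[C]_(m, n)) (A : 'M[C]_n) :
  psdmx A -> psdmx (M *m A *m M ^t*).
Proof.
move=> [AH A0]; split=> [|v].
  by rewrite !trmx_mul !map_mxM trmxCK AH mulmxA.
have -> : v *m (M *m A *m M ^t*) *m v ^t* = (v *m M) *m A *m (v *m M) ^t*.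
  by rewrite trmx_mul map_mxM !mulmxA.
exact: A0.
Qed.

Lemma psdmx_diag n (A : 'M[C]_n) i : psdmx A -> 0 <= A i i.
Proof.
move=> [_ /(_ (delta_mx 0 i))].
rewrite -rowE trmx_delta map_delta_mx -colE !mxE.
by [].
Qed.

Lemma psdmxD n (A B : 'M[C]_n) : psdmx A -> psdmx B -> psdmx (A + B).
Proof.
move=> [AH A0] [BH B0]; split=> [|v]; first by rewrite linearD map_mxD AH BH.
by rewrite mulmxDr mulmxDl mxE addr_ge0.
Qed.

(** The quadratic form of this matrix is d |v_i|^2. *)
Lemma psdmx_delta n (i : 'I_n) d :
  0 <= d -> psdmx (d *: delta_mx i i : 'M[C]_n).
Proof.
move=> d0; split=> [|v].
  apply/matrixP => a b; rewrite !mxE rmorphM/= rmorph_nat.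
  by rewrite (CrealP _) ?ger0_real// andbC.
rewrite -scalemxAr -scalemxAl mxE mulr_ge0//.
rewrite -(mul_delta_mx (0 : 'I_1)) mulmxA -colE -mulmxA -rowE mxE big_ord1.
by rewrite !mxE mul_conjC_ge0.
Qed.

(** The principal minor is M A M^*, where M is the identity matrix without its row i. *)
Lemma psdmx_row'_col' n (A : 'M[C]_n) i : psdmx A -> psdmx (row' i (col' i A)).
Proof.
move=> /(psdmx_conj _ _ (rowsub (lift i) 1%:M)).
have -> : (rowsub (lift i) 1%:M) ^t* = colsub (lift i) (1%:M : 'M[C]_n).
  by apply/matrixP => a b; rewrite !mxE rmorph_nat eq_sym.
rewrite mulmx_colsub mulmx1 mul_rowsub_mx mul1mx; congr psdmx.
by apply/matrixP => a b; rewrite !mxE.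
Qed.

(** The eigenvalues are the diagonal entries of P A P^*, which is again positive semidefinite by
    congruence. *)
Lemma psdmx_spectral n (A : 'M[C]_n) : psdmx A ->
  exists P : 'M[C]_n, exists D : 'rV[C]_n,
  [/\ P \is unitarymx, A = invmx P *m diag_mx D *m P & forall i, 0 <= D 0 i].
Proof.
move=> Apsd; have [AH A0] := Apsd.
have /hermitian_normalmx/orthomx_spectralP AE : A \is hermsymmx.
  by apply/is_hermitianmxP; rewrite expr0 scale1r AH.
have PU := spectral_unitarymx A; set P := spectralmx A in AE PU *.
exists P, (spectral_diag A); split=> // i.
have := psdmx_diag _ _ i (psdmx_conj _ _ P _ Apsd).
rewrite [X in _ *m X *m _]AE -invmx_unitary// !mulmxA mulmxV ?unitarymx_unit//.
by rewrite mul1mx mulmxK ?unitarymx_unit// mxE eqxx.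
Qed.

(** After diagonalisation the polynomial is the product of the X + d_i with d_i >= 0. *)
Lemma psdmx_char_poly_ge0 n (A : 'M[C]_n) i :
  psdmx A -> 0 <= (char_poly (- A))`_i.
Proof.
move=> /psdmx_spectral[P [D [PU -> D0]]].
rewrite char_poly_oppconj ?unitarymx_unit//.
by rewrite char_poly_opp_diag coef_prod_XaddC_ge0.
Qed.

(* Each unit of a diagonal entry adds the characteristic polynomial of a
   principal minor, whose coefficients are nonnegative. *)
Lemma psdmx_char_poly_add_diag n (A : 'M[C]_n) (D : 'rV[C]_n) i :
  psdmx A -> (forall j, 0 <= D 0 j) ->
  (char_poly (- A))`_i <= (char_poly (- (A + diag_mx D)))`_i.
Proof.
move=> Apsd D0; rewrite diag_mx_sum_delta.
(* The induction also carries semidefiniteness of the partial sum S: the next step needs the minors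
   of A + S to be semidefinite. *)
pose good S := psdmx S /\ (char_poly (- A))`_i <= (char_poly (- (A + S)))`_i.
have : good (\sum_j (D 0 j *: delta_mx j j)); last by case.
apply: (big_rec good); rewrite /good.
  rewrite addr0; split=> //; split=> [|v]; first by rewrite trmx0 map_mx0.
  by rewrite mulmx0 mul0mx mxE.
move=> j S _ [Spsd le]; split; first by apply: psdmxD => //; apply: psdmx_delta.
rewrite addrCA addrC char_poly_add_delta coefD coefZ (le_trans le)// lerDl.
rewrite mulr_ge0//; apply/psdmx_char_poly_ge0/psdmx_row'_col'.
exact: psdmxD.
Qed.

(** In a unitary basis that diagonalises B - A, the matrix B is A plus a nonnegative diagonal, and
    characteristic polynomials do not see the change of basis. *)
Lemma psdmx_char_poly_le n (A B : 'M[C]_n) i : psdmx A -> psdmx (B - A) ->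
  (char_poly (- A))`_i <= (char_poly (- B))`_i.
Proof.
move=> Apsd /psdmx_spectral[P [D [PU BAE D0]]].
have Pu := unitarymx_unit PU.
pose A' := P *m A *m invmx P.
have AE : A = invmx P *m A' *m P by rewrite /A' !mulmxA mulVmx// mul1mx mulmxKV.
have BE : B = invmx P *m (A' + diag_mx D) *m P.
  by rewrite mulmxDr mulmxDl -AE -BAE addrC subrK.
rewrite BE [in leLHS]AE !char_poly_oppconj//.
apply: psdmx_char_poly_add_diag => //.
by rewrite /A' invmx_unitary//; apply: psdmx_conj.
Qed.
End Hermitian.

Lemma coef_prod_XaddC_esym {R : realType} m k (lam : 'rV[R]_m) : (k <= m)%N ->
  (\prod_i ('X + (lam 0 i)%:P))`_(m - k) = Defs.esym k lam.
Proof.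
move=> km; rewrite /Defs.esym bigA_distr coef_sum [RHS]big_mkcond/=.
(* The expanded product is indexed by the set of factors contributing X; complements index it by the
   factors contributing [lam]. *)
rewrite (reindex_inj (inv_inj (@finset.setCK _)))/=; apply: eq_bigr => I _.
rewrite (bigID (mem I))/=.
rewrite (eq_bigr (fun i => (lam 0 i)%:P)); last by move=> i iI; rewrite inE iI.
rewrite [X in _ * X](eq_bigr (fun i => 'X)); last first.
  by move=> i iI; rewrite inE iI.
rewrite -rmorph_prod/= prodr_const coefCM coefXn.
have -> : #|[predC I]| = (m - #|I|)%N.
  have := cardC I; rewrite card_ord => /(congr1 (subn^~ #|I|)) <-.
  by rewrite addKn.
have Im : (#|I| <= m)%N by have := max_card I; rewrite card_ord.
have -> : ((m - k)%N == (m - #|I|)%N) = (#|I| == k).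
  apply/eqP/eqP => [/(congr1 (subn m))|->//].
  by rewrite !subKn// => /esym.
by case: eqP; rewrite ?mulr1 ?mulr0.
Qed.

(** * Transfer to real symmetric matrices and to sigma_k *)

Section RealSymmetric.
Local Open Scope sesquilinear_scope.
Local Open Scope complex_scope.

Lemma conjC_conjc {R : realType} (z : R[i]) : Num.conj z = conjc z.
Proof. by []. Qed.

Context {R : realType} {m : nat}.
Implicit Types A B : 'M[R]_m.

Definition real_psdmx A : Prop :=
  A^T = A /\ forall v : 'rV_m, 0 <= (v *m A *m v^T) 0 0.

Notation mxC := (map_mx (real_complex R)).

(** For v = a + i b the form equals a A a^T + b A b^T; the imaginary part b A a^T - a A b^T vanishes
    by symmetry. *)
Lemma psdmx_complexify A : real_psdmx A -> psdmx (mxC A : 'M[R[i]]_m).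
Proof.
move=> [AT A0]; split=> [|v].
  by apply/matrixP => i j; rewrite !mxE -[in RHS]AT mxE conjC_conjc conjc_real.
pose a : 'rV[R]_m := \row_j complex.Re (v 0 j).
pose b : 'rV[R]_m := \row_j complex.Im (v 0 j).
have -> : v = mxC a + 'i%C *: mxC b.
  by apply/rowP => j; rewrite !mxE -complexE.
have conjab : (mxC a + 'i%C *: mxC b) ^t* = mxC a^T - 'i%C *: mxC b^T.
  apply/colP => j; rewrite !mxE conjC_conjc; apply/eqP.
  by rewrite eq_complex/= !(mul0r, mul1r, addr0, add0r, subr0, oppr0) !eqxx.
rewrite conjab.
have -> : (mxC a + 'i%C *: mxC b) *m mxC A *m (mxC a^T - 'i%C *: mxC b^T) =
  mxC (a *m A *m a^T + b *m A *m b^T) +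
  'i%C *: mxC (b *m A *m a^T - a *m A *m b^T).
  rewrite !mulmxDl !mulmxBr -!scalemxAr -!scalemxAl !scalerA -expr2 sqr_i.
  rewrite scaleN1r opprK.
  rewrite map_mxD map_mxB scalerBr !map_mxM -!addrA; congr (_ + _).
  by rewrite addrCA [RHS]addrCA [in RHS](addrC (_ *m _)).
have -> : b *m A *m a^T - a *m A *m b^T = 0.
  apply/eqP; rewrite subr_eq0; apply/eqP/matrixP => i j; rewrite !ord1.
  transitivity ((b *m A *m a^T)^T 0 0); first by rewrite [RHS]mxE.
  by rewrite !trmx_mul trmxK AT mulmxA.
by rewrite map_mx0 scaler0 addr0 mxE ler0c mxE addr_ge0.
Qed.

(** The complexified matrix is Hermitian, so its spectrum is real, and the factorisation over [R[i]]
    descends to R because the coefficient embedding is injective on polynomials. *)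
Lemma symmetric_split A : A^T = A ->
  exists lam : 'rV[R]_m, char_poly A = \prod_i ('X - (lam 0 i)%:P).
Proof.
move=> AT; have AH : (mxC A : 'M[R[i]]_m) \is hermsymmx.
  apply/is_hermitianmxP; rewrite expr0 scale1r.
  by apply/matrixP => i j; rewrite !mxE -[in LHS]AT mxE conjC_conjc conjc_real.
have /mxOverP Dr := hermitian_spectral_diag_real AH.
have /hermitian_normalmx/orthomx_spectralP AE := AH.
exists (\row_i complex.Re (spectral_diag (mxC A) 0 i)).
apply: (map_poly_inj (real_complex R)); rewrite map_char_poly [in LHS]AE.
rewrite char_poly_conj ?spectral_unit// char_poly_trig ?diag_mx_is_trig//.
rewrite rmorph_prod; apply: eq_bigr => i _.
by rewrite rmorphB/= map_polyX map_polyC/= !mxE eqxx mulr1n RRe_real.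
Qed.

(** Up to sign, elementary symmetric functions of the roots are coefficients of the characteristic
    polynomial. This makes [sigma] independent of the chosen ordering of the eigenvalues. *)
Lemma sigmaE k A : (k <= m)%N -> A^T = A ->
  sigma k A = (char_poly (- A))`_(m - k).
Proof.
move=> km AT; rewrite /sigma /eigenvalues.
(* The default value of [xget] cannot occur, since a symmetric matrix splits over R. *)
case: xgetP => [lam _ /= AE|/(_ _)/= no]; last first.
  by have [lam AE] := symmetric_split A AT; case: (no lam).
rewrite -coef_prod_XaddC_esym// -char_poly_opp_diag.
apply: (@mulfI _ ((-1) ^+ (m - k))); first by rewrite signr_eq0.
(* The scaling rule with factor -1 reduces the claim to [A] and [diag_mx lam] having the same
   characteristic polynomial. *)
have oppE (B : 'M[R]_m) : (-1) ^+ (m - k) * (char_poly (- B))`_(m - k) =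
    (-1) ^+ m * (char_poly B)`_(m - k).
  by have := coef_char_polyZ R m B (-1) (m - k); rewrite scaleN1r.
rewrite !oppE AE char_poly_trig ?diag_mx_is_trig//.
have diagE i : (diag_mx lam) i i = lam 0 i by rewrite mxE eqxx mulr1n.
by rewrite (eq_bigr (fun i => 'X - (lam 0 i)%:P)) => [//|i _]; rewrite diagE.
Qed.

(** The scaling rule for coefficients gives this after cancelling c^(m - k), whence c != 0. *)
Lemma sigmaZ k c A : c != 0 -> (k <= m)%N -> A^T = A ->
  sigma k (c *: A) = c ^+ k * sigma k A.
Proof.
move=> c0 km AT; rewrite !sigmaE//; last by rewrite linearZ/= AT.
apply: (@mulfI _ (c ^+ (m - k))); first by rewrite expf_neq0.
have := coef_char_polyZ R m (- A) c (m - k); rewrite scalerN => ->.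
by rewrite mulrA -exprD subnK.
Qed.

Lemma sigma_le k A B : (k <= m)%N -> real_psdmx A -> real_psdmx (B - A) ->
  sigma k A <= sigma k B.
Proof.
move=> km Ap BAp; have [AT _] := Ap; have [BAT _] := BAp.
have BT : B^T = B by rewrite -[B](subrK A) linearD/= BAT AT.
rewrite !sigmaE// -lecR -!coef_map !map_char_poly !map_mxN.
apply: psdmx_char_poly_le; first exact: psdmx_complexify.
by rewrite -map_mxB; apply: psdmx_complexify.
Qed.
End RealSymmetric.

(** * Derivatives along lines *)

(** Here [psi] is the derivative of [phi] and [l] the second derivative at 0. If l > 0, then psi > 0
    just to the right of 0, and the mean value theorem makes phi exceed its maximum there. *)
Lemma second_derivative_test (R : realType) (phi psi : R -> R) (l d : R) :
  0 < d -> (forall s : R, `|s| < d -> is_derive s 1 phi (psi s)) ->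
  is_derive (0 : R) 1 psi l -> (forall s, `|s| < d -> phi s <= phi 0) ->
  psi 0 = 0 /\ l <= 0.
Proof.
move=> d0 dphi dpsi maxphi.
have psi0 : psi 0 = 0.
  have in0 : 0 \in `](- d), d[ by rewrite in_itv/= oppr_lt0 d0.
  have nd t : t \in `](- d), d[ -> `|t| < d.
    by rewrite in_itv/= ltr_norml.
  have := @derive1_at_max _ phi (- d) d 0.
  case=> //.
  - by rewrite ltW// (lt_trans _ d0)// oppr_lt0.
  - by move=> t /nd/dphi[].
  - by move=> t /nd/maxphi.
  by move=> _; have [_ ->] := dphi 0 ltac:(by rewrite normr0).
split=> //; rewrite leNgt; apply/negP => l0.
have [psi_der psiE] := dpsi.
have : (fun h => h^-1 *: (psi (h *: 1 + 0) - psi 0)) @ 0^' --> l.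
  by rewrite -psiE; exact: psi_der.
move=> /cvgr_gt/(_ 0 l0)[e /= e0 he].
(* Halving keeps the closed interval [0, t] strictly inside both neighbourhoods. *)
pose t := Num.min d e / 2.
have m0 : 0 < Num.min d e by rewrite lt_min d0.
have t0 : 0 < t by rewrite divr_gt0.
have tm : t < Num.min d e by rewrite ltr_pdivrMr// ltr_pMr// ltr1n.
have [td te] : t < d /\ t < e.
  by move: tm; rewrite lt_min => /andP.
have psi_gt0 s : 0 < s <= t -> 0 < psi s.
  move=> /andP[s0 st]; have := he s.
  rewrite /= sub0r normrN gtr0_norm// (le_lt_trans st te) => /(_ isT).
  rewrite gt_eqF// => /(_ isT).
  by rewrite psi0 subr0 addr0 [s *: 1]mulr1 [_ *: _]mulrC pmulr_lgt0// invr_gt0.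
have [] := @MVT R phi psi 0 t t0.
- move=> s; rewrite in_itv/= => /andP[s0 st]; apply: dphi.
  by rewrite gtr0_norm// (lt_trans st).
- apply: derivable_within_continuous => s; rewrite in_itv/= => /andP[s0 st].
  have [] := dphi s => //.
  by rewrite ger0_norm// (le_lt_trans st).
move=> s; rewrite in_itv/= => /andP[s0 st] ME.
have : 0 < phi t - phi 0.
  by rewrite ME subr0 mulr_gt0// psi_gt0// s0 ltW.
by rewrite subr_gt0 ltNge maxphi// gtr0_norm.
Qed.

(** Both difference quotients are the same function of the increment, so one-variable calculus
    applies along lines. *)
Lemma is_derive_line (R : numFieldType) (V W : normedModType R) (G : V -> W)
    (x v : V) (s : R) : derivable G (x + s *: v) v ->
  is_derive s 1 (fun t => G (x + t *: v)) ('D_v G (x + s *: v)).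
Proof.
have E : (fun h : R =>
      h^-1 *: (((fun t => G (x + t *: v)) \o shift s) (h *: 1) -
               G (x + s *: v))) =
    (fun h : R =>
      h^-1 *: ((G \o shift (x + s *: v)) (h *: v) - G (x + s *: v))).
  apply/funext => h /=; rewrite [h *: 1]mulr1 scalerDl addrCA.
  by congr (_ *: (G _ - _)).
by move=> dG; split; rewrite ?/derivable ?/derive E.
Qed.

Lemma MVT_line (R : realType) (V : normedModType R) (G : V -> R)
    (x v : V) (t : R) :
  0 < t -> (forall s, 0 <= s <= t -> derivable G (x + s *: v) v) ->
  exists2 s, 0 <= s <= t & G (x + t *: v) - G x = 'D_v G (x + s *: v) * t.
Proof.
move=> t0 dG.
have [] := @MVT R (fun s => G (x + s *: v))
  (fun s => 'D_v G (x + s *: v)) 0 t t0.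
- move=> s; rewrite in_itv/= => /andP[s0 st]; apply: is_derive_line.
  by apply: dG; rewrite !ltW.
- apply: derivable_within_continuous => s; rewrite in_itv/= => st.
  by have [] := is_derive_line _ _ _ _ _ _ _ (dG s st).
move=> s; rewrite in_itv/= => /andP[s0 st]; rewrite scale0r addr0 subr0 => E.
by exists s; rewrite // !ltW.
Qed.

Lemma is_derive_translate (R : numFieldType) (V W : normedModType R)
    (G : V -> W) (a x v : V) : derivable G (x + a) v ->
  is_derive x v (fun y => G (y + a)) ('D_v G (x + a)).
Proof.
have E : (fun h : R => h^-1 *: (((fun y => G (y + a)) \o shift x) (h *: v) -
      G (x + a))) =
    (fun h : R => h^-1 *: ((G \o shift (x + a)) (h *: v) - G (x + a))).
  by apply/funext => h /=; rewrite addrA.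
by move=> dG; split; rewrite ?/derivable ?/derive E.
Qed.

(** The mean value theorem is used twice: along v for y |-> G (y + t w) - G y, then along w for the
    derivative of G in direction v. *)
Lemma mixed_difference (R : realType) (V : normedModType R) (G : V -> R)
    (x v w : V) (t : R) : 0 < t ->
  (forall s r, 0 <= s <= t -> 0 <= r <= t ->
    derivable G (x + s *: v + r *: w) v /\
    derivable ('D_v G) (x + s *: v + r *: w) w) ->
  exists2 sr, (0 <= sr.1 <= t) && (0 <= sr.2 <= t) &
    G (x + t *: v + t *: w) - G (x + t *: v) - (G (x + t *: w) - G x) =
    'D_w ('D_v G) (x + sr.1 *: v + sr.2 *: w) * t * t.
Proof.
move=> t0 dG.
have tt : 0 <= t <= t by rewrite ltW/=.
have t00 : 0 <= (0 : R) <= t by rewrite lexx ltW.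
have dH s : 0 <= s <= t -> is_derive (x + s *: v) v
    (fun y => G (y + t *: w) - G y)
    ('D_v G (x + s *: v + t *: w) - 'D_v G (x + s *: v)).
  move=> st; apply: is_deriveB.
    by apply: is_derive_translate; have [] := dG _ _ st tt.
  by apply: derivableP; have [] := dG _ _ st t00; rewrite scale0r addr0.
have [s st] := @MVT_line R V (fun y => G (y + t *: w) - G y) x v t t0
  (fun s st => @ex_derive _ _ _ _ _ _ _ (dH s st)).
rewrite (@derive_val _ _ _ _ _ _ _ (dH s st)) => ->.
have [r rt ->] := @MVT_line R V ('D_v G) (x + s *: v) w t t0
  (fun r rt => (dG s r st rt).2).
by exists (s, r) => //=; rewrite st rt.
Qed.

Lemma half_dist_absurd (R : realFieldType) (a b c : R) :
  `|a - c| < `|a - b| / 2 -> `|b - c| < `|a - b| / 2 -> False.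
Proof.
move=> h1 h2; have := ltrD h1 h2; rewrite -splitr ltNge => /negP; apply.
by rewrite (le_trans (ler_distD c _ _))// lerD// distrC.
Qed.

(* Near x both mixed derivatives take the value of the same second difference
   quotient. *)
Lemma derive_comm (R : realType) (V : normedModType R) (G : V -> R)
    (x v w : V) :
  (\forall y \near x, [/\ derivable G y v, derivable G y w,
     derivable ('D_v G) y w & derivable ('D_w G) y v]) ->
  {for x, continuous ('D_w ('D_v G))} -> {for x, continuous ('D_v ('D_w G))} ->
  'D_w ('D_v G) x = 'D_v ('D_w G) x.
Proof.
move=> dG cwv cvw; apply/eqP; rewrite -subr_eq0 -normr_le0 leNgt; apply/negP.
set A := 'D_w _ _; set B := 'D_v _ _ => AB.
have e0 : 0 < `|A - B| / 2 by rewrite divr_gt0.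
have := cvgr_dist_lt _ _ cwv _ e0; rewrite -/A => nA.
have := cvgr_dist_lt _ _ cvw _ e0; rewrite -/B => nB.
have [d /= d0 hd] := (nbhs_normP _ _).1 (filterI dG (filterI (nA _) (nB _))).
(* Since t M = d / 2, the whole parallelogram spanned by t v and t w stays within distance d of x;
   the summand 1 keeps M positive. *)
pose M := `|v| + `|w| + 1; pose t := d / 2 / M.
have M0 : 0 < M by rewrite ltr_wpDl// addr_ge0.
have t0 : 0 < t by rewrite !divr_gt0.
have box s r : 0 <= s <= t -> 0 <= r <= t ->
    `|x - (x + s *: v + r *: w)| < d.
  move=> /andP[s0 st] /andP[r0 rt].
  rewrite -addrA opprD addrA subrr add0r normrN.
  rewrite (le_lt_trans (ler_normD _ _))// !normrZ !ger0_norm//.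
  have : s * `|v| + r * `|w| <= t * M.
    rewrite mulrDr mulrDr -addrA lerD ?ler_wpM2r// ler_wpDr ?ler_wpM2r//.
    by rewrite mulr1 ltW.
  rewrite /t divfK ?gt_eqF// => /le_lt_trans; apply.
  by rewrite gtr_pMr// invf_lt1// ltr1n.
have [|[s r]/= /andP[st rt] E1] := @mixed_difference R V G x v w t t0.
  move=> s r st rt; have [[dGv _ dwv _] _] := hd _ (box s r st rt).
  exact: (conj dGv dwv).
have [|[s' r']/= /andP[st' rt'] E2] := @mixed_difference R V G x w v t t0.
  move=> s' r' st' rt'; rewrite -addrA [s' *: w + _]addrC addrA.
  have [[_ dGw _ dvw] _] := hd _ (box r' s' rt' st'); exact: (conj dGw dvw).
(* The second difference is symmetric in v and w, so the two intermediate values agree. *)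
have E : 'D_w ('D_v G) (x + s *: v + r *: w) =
         'D_v ('D_w G) (x + s' *: w + r' *: v).
  move: E2; rewrite -[x + t *: w + _]addrA [t *: w + _]addrC addrA => E2.
  have swap (a b c e : R) : a - b - (c - e) = a - c - (b - e) by ring.
  rewrite swap E1 in E2.
  by move: E2 => /(mulIf (lt0r_neq0 t0))/(mulIf (lt0r_neq0 t0)).
have [_ [h1 _]] := hd _ (box s r st rt).
have [_ [_ ]] := hd _ (box r' s' rt' st').
rewrite -addrA [r' *: v + _]addrC addrA => h2.
rewrite -E in h2.
exact: (half_dist_absurd _ _ _ _ h1 h2).
Qed.

(** * Calculus on the sphere *)

Section Euclid.
Context {R : realType} {n : nat}.
Implicit Types (x y v w : 'rV[R]_n) (F G : 'rV[R]_n -> R).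

Lemma dotE v w : dot v w = \sum_i v 0 i * w 0 i.
Proof. by rewrite /dot mxE; apply: eq_bigr => i _; rewrite mxE. Qed.

Lemma dotC v w : dot v w = dot w v.
Proof. by rewrite !dotE; apply: eq_bigr => i _; rewrite mulrC. Qed.

Lemma dotDl u v w : dot (u + v) w = dot u w + dot v w.
Proof. by rewrite /dot mulmxDl mxE. Qed.

Lemma dotZl c v w : dot (c *: v) w = c * dot v w.
Proof. by rewrite /dot -scalemxAl mxE. Qed.

Lemma dotDr u v w : dot w (u + v) = dot w u + dot w v.
Proof. by rewrite !(dotC w) dotDl. Qed.

Lemma dotZr c v w : dot w (c *: v) = c * dot w v.
Proof. by rewrite !(dotC w) dotZl. Qed.

Lemma dot_ge0 v : 0 <= dot v v.
Proof. by rewrite dotE sumr_ge0// => i _; rewrite -expr2 sqr_ge0. Qed.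

Lemma dot_eq0 v : (dot v v == 0) = (v == 0).
Proof.
apply/idP/eqP => [|->]; last by rewrite /dot mul0mx mxE.
rewrite dotE psumr_eq0 => [/allP v0|i _]; last by rewrite -expr2 sqr_ge0.
apply/rowP => i; have := v0 i; rewrite mem_index_enum => /(_ isT)/=.
by rewrite mulf_eq0 orbb mxE => /eqP.
Qed.

Lemma enorm_gt0 y : y != 0 -> 0 < enorm y.
Proof. by move=> y0; rewrite sqrtr_gt0 lt_def dot_eq0 y0 dot_ge0. Qed.

Lemma enormZ c y : 0 <= c -> enorm (c *: y) = c * enorm y.
Proof.
move=> c0; rewrite /enorm dotZl dotZr mulrA -expr2 sqrtrM ?sqr_ge0//.
by rewrite sqrtr_sqr ger0_norm.
Qed.

Lemma sphere_enorm x : sphere x -> enorm x = 1.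
Proof. by rewrite /sphere/= /enorm => ->; rewrite sqrtr1. Qed.

Lemma sphere_neq0 x : sphere x -> x != 0.
Proof.
by move=> x1; rewrite -dot_eq0 (x1 : dot x x = 1) oner_neq0.
Qed.

Lemma sphere_normalize y : y != 0 -> sphere ((enorm y)^-1 *: y).
Proof.
move=> y0; have e0 := enorm_gt0 _ y0.
rewrite /sphere/= dotZl dotZr mulrA -expr2 -[dot y y]sqr_sqrtr ?dot_ge0//.
by rewrite -/(enorm y) -exprMn mulVf ?gt_eqF// expr1n.
Qed.

Lemma radial_sphere {T : Type} (F : 'rV[R]_n -> T) x :
  sphere x -> radial F x = F x.
Proof. by move=> x1; rewrite /radial sphere_enorm// invr1 scale1r. Qed.

Lemma radialZ {T : Type} (F : 'rV[R]_n -> T) c y : 0 < c ->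
  radial F (c *: y) = radial F y.
Proof.
move=> c0; rewrite /radial enormZ ?ltW// scalerA invfM.
by rewrite mulrAC mulVf ?mul1r// gt_eqF.
Qed.

Lemma open_neq0 : open [set y : 'rV[R]_n | y != 0].
Proof.
rewrite (_ : [set y | y != 0] = ~` [set 0]); last first.
  by apply/seteqP; split=> y /= /eqP.
apply/closed_openC/accessible_closed_set1/hausdorff_accessible.
exact: norm_hausdorff.
Qed.

Lemma near_neq0 x : x != 0 -> \forall y \near x, y != 0.
Proof. by move=> x0; apply: open_nbhs_nbhs; split=> //; exact: open_neq0. Qed.

(** The radial extension is homogeneous of degree 0, so its values at c y + t v and y + (t / c) v
    agree; differentiating at t = 0 produces the factor 1 / c. *)
Lemma derive_radialZ F c y v : smooth_sphere F -> 0 < c -> y != 0 ->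
  'D_v (radial F) (c *: y) = c^-1 * 'D_v (radial F) y.
Proof.
move=> Fs c0 y0; have dF z : z != 0 -> differentiable (radial F) z.
  by move=> z0; exact: (Fs [::]).
have cy0 : c *: y != 0 by rewrite scaler_eq0 negb_or gt_eqF.
have d1 : is_derive (0 : R) 1 (fun t : R => radial F (c *: y + t *: v))
    ('D_v (radial F) (c *: y)).
  have := @is_derive_line R _ _ (radial F) (c *: y) v 0.
  rewrite scale0r addr0; apply; exact/diff_derivable/dF.
have d2 : is_derive (0 : R) 1 (fun t : R => radial F (y + t *: v))
    ('D_v (radial F) y).
  have := @is_derive_line R _ _ (radial F) y v 0.
  rewrite scale0r addr0; apply; exact/diff_derivable/dF.
have E : (fun t : R => radial F (c *: y + t *: v)) =
    (fun t : R => radial F (y + t *: v)) \o (fun t : R => c^-1 * t).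
  apply/funext => t /=; rewrite -(radialZ F c (y + _) c0) scalerDr scalerA.
  by rewrite mulrA mulfV ?mul1r// gt_eqF.
have d3 : is_derive (0 : R) 1 (fun t : R => c^-1 * t) c^-1.
  by apply: is_derive_eq; rewrite scaler1// addr0.
have := @is_derive1_comp R (fun t : R => radial F (y + t *: v))
  (fun t : R => c^-1 * t) 0 ('D_v (radial F) y) c^-1.
rewrite mulr0 -E mulrC => /(_ d2 d3) d4.
by rewrite -(@derive_val _ _ _ _ _ _ _ d1) (@derive_val _ _ _ _ _ _ _ d4).
Qed.

Lemma radial_sgrad F y : smooth_sphere F -> y != 0 ->
  radial (sgrad F) y = enorm y *: partials (radial F) y.
Proof.
move=> Fs y0; apply/rowP => j; rewrite !mxE.
by rewrite derive_radialZ ?invr_gt0 ?enorm_gt0// invrK.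
Qed.

(** Along a tangent direction |x + s v| is the square root of 1 + |v|^2 s^2, which has no
    first-order term. *)
Lemma is_derive_enorm x v : sphere x -> dot x v = 0 -> is_derive x v enorm 0.
Proof.
move=> x1 xv0.
pose q : R -> R := cst 1 + (dot v v) *: (id : R -> R) ^+ 2.
have qE s : q s = 1 + dot v v * s ^+ 2 by [].
have E : (fun h : R => h^-1 *: ((enorm \o shift x) (h *: v) - enorm x)) =
   (fun h : R =>
      h^-1 *: (((Num.sqrt \o q) \o shift 0) (h *: 1) - (Num.sqrt \o q) 0)).
  apply/funext => h.
  rewrite /= !qE expr0n mulr0 !addr0 sqrtr1 (sphere_enorm _ x1).
  rewrite /enorm dotDl !dotDr !dotZl !dotZr (dotC v x) xv0 (x1 : dot x x = 1).
  rewrite [h *: 1]mulr1; congr (_ *: (Num.sqrt _ - _)).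
  by ring.
have dq : is_derive (0 : R) 1 q 0.
  have d1 := is_deriveX 2 (is_derive_id (0 : R) 1).
  have d2 := is_deriveZ (dot v v) d1.
  have d3 := is_deriveD (is_derive_cst (1 : R) (0 : R) 1) d2.
  apply: is_derive_eq d3 _.
  by rewrite /= expr1 mulr0 scale0r scaler0 addr0.
have ds : is_derive (0 : R) 1 (Num.sqrt \o q) 0.
  have q0 : 0 < q 0 by rewrite qE expr0n mulr0 addr0.
  by have := is_derive1_comp (is_derive1_sqrt q0) dq; rewrite mulr0.
have [c0 d0] := ds.
by split; rewrite ?/derivable ?/derive E.
Qed.

Definition hessian G x : 'M[R]_n :=
  \matrix_(i, j) 'D_(delta_mx 0 i) ('D_(delta_mx 0 j) G) x.

Lemma derive_partials G y w : differentiable G y ->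
  'D_w G y = \sum_j w 0 j * 'D_(delta_mx 0 j) G y.
Proof.
move=> dG; rewrite deriveE// [in LHS](row_sum_delta w) linear_sum.
by apply: eq_bigr => j _; rewrite linearZ/= deriveE.
Qed.

Lemma smooth_on_differentiable U G x :
  smooth_on U G -> U x -> differentiable G x.
Proof. by move=> /(_ [::]); exact. Qed.

Lemma smooth_on_derive U G v : smooth_on U G -> smooth_on U ('D_v G).
Proof.
move=> Gs vs x Ux; have := Gs (rcons vs v) x Ux.
by rewrite /iter_deriv foldr_rcons.
Qed.

Lemma hessianE U G x v w : smooth_on U G -> open U -> U x ->
  'D_v ('D_w G) x = (v *m hessian G x *m w^T) 0 0.
Proof.
move=> Gs oU Ux.
(* The expansion in partial derivatives is needed on a neighbourhood of x, because it is
   differentiated once more. *)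
have E : \forall y \near x,
    (\sum_j (w 0 j *: 'D_(delta_mx 0 j) G : 'rV[R]_n -> R)) y = 'D_w G y.
  have : \forall y \near x, U y by apply: open_nbhs_nbhs.
  apply: filterS => y Uy; have dG := smooth_on_differentiable _ _ _ Gs Uy.
  by rewrite (derive_partials _ _ _ dG) fct_sumE.
rewrite -(near_eq_derive _ E).
have dj j : differentiable ('D_(delta_mx 0 j) G) x.
  exact: smooth_on_differentiable (smooth_on_derive _ _ _ Gs) Ux.
rewrite derive_sum => [|j]; last exact/derivableZ/diff_derivable.
rewrite mxE; apply: eq_bigr => j _; rewrite deriveZ; last exact: diff_derivable.
rewrite (derive_partials _ _ v)// !mxE mulrC; congr (_ * _).
by apply: eq_bigr => i _; rewrite mxE.
Qed.

Lemma hessian_sym U G x : smooth_on U G -> open U -> U x ->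
  (hessian G x)^T = hessian G x.
Proof.
move=> Gs oU Ux; apply/matrixP => i j; rewrite !mxE.
set a := delta_mx 0 i; set b := delta_mx 0 j.
have D vs y : U y -> differentiable (iter_deriv vs G) y by exact: Gs.
apply: derive_comm.
- have : \forall y \near x, U y by apply: open_nbhs_nbhs.
  apply: filterS => y Uy; split; apply: diff_derivable.
  + exact: (D [::]).
  + exact: (D [::]).
  + exact: (D [:: a]).
  + exact: (D [:: b]).
- exact/differentiable_continuous/(D [:: b; a]).
- exact/differentiable_continuous/(D [:: a; b]).
Qed.

(* The factor |y| in radial_sgrad has derivative 0 along tangent vectors, so the
   covariant Hessian is the ambient one of the radial extension. *)
Lemma shessE F x v w : smooth_sphere F -> sphere x -> dot x v = 0 ->
  shess F x v w = (v *m hessian (radial F) x *m w^T) 0 0.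
Proof.
move=> Fs x1 xv.
have E j : is_derive x v (fun y => radial (sgrad F) y 0 j)
   ('D_v ('D_(delta_mx 0 j) (radial F)) x).
  have dj : differentiable ('D_(delta_mx 0 j) (radial F)) x.
    exact: (Fs [:: delta_mx 0 j] x (sphere_neq0 _ x1)).
  (* The product formula for [radial (sgrad F)] holds off the origin, hence near x, which determines
     the derivative at x. *)
  apply: (@near_eq_is_derive _ _ _ (enorm * 'D_(delta_mx 0 j) (radial F))).
    apply: filterS (near_neq0 _ (sphere_neq0 _ x1)) => y y0.
    by rewrite radial_sgrad// !mxE.
  apply: is_derive_eq.
    apply: is_deriveM; first exact: is_derive_enorm.
    exact/derivableP/diff_derivable.
  by rewrite /= scaler0 addr0 sphere_enorm// scale1r.
rewrite /shess derive_mx; last first.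
  by apply/derivable_mxP => i j; rewrite ord1; have [] := E j.
rewrite dotE mxE; apply: eq_bigr => j _; rewrite !mxE; congr (_ * _).
have [_ ->] := E j; rewrite derive_partials; last first.
  exact: (Fs [:: delta_mx 0 j] x (sphere_neq0 _ x1)).
by apply: eq_bigr => i _; rewrite mxE.
Qed.

End Euclid.

(** Provides an orthonormal basis with first vector x, whose other vectors span the tangent space at
    x. *)
Lemma orthogonal_completion (R : realType) m (x : 'rV[R]_m.+1) : sphere x ->
  exists H : 'M[R]_m.+1, H *m H^T = 1%:M /\ row 0 H = x.
Proof.
move=> x1; pose e : 'rV[R]_m.+1 := delta_mx 0 0.
have e1 : dot e e = 1 by rewrite /dot trmx_delta mul_delta_mx mxE.
have xe : dot x e = x 0 0 by rewrite /dot trmx_delta -colE mxE.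
pose w := x - e; have [w0|wN0] := eqVneq w 0.
  exists 1%:M; rewrite trmx1 mulmx1; split=> //.
  by rewrite row1 -/e; apply/esym/eqP; rewrite -subr_eq0 -/w w0.
pose a := dot w w.
have a0 : a != 0 by rewrite dot_eq0.
have aE : a = 2 * (1 - x 0 0).
  rewrite /a /w -scaleN1r dotDl !dotDr !dotZl !dotZr e1 (dotC e) xe.
  by rewrite (x1 : dot x x = 1); ring.
have wwE : w *m w^T = a%:M by rewrite [LHS]mx11_scalar.
(* the reflection exchanging e and x *)
exists (1%:M - (2 / a) *: (w^T *m w)); split.
  have -> : (1%:M - (2 / a) *: (w^T *m w))^T = 1%:M - (2 / a) *: (w^T *m w).
    by rewrite linearB linearZ/= trmx1 trmx_mul trmxK.
  have MM : (w^T *m w) *m (w^T *m w) = a *: (w^T *m w).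
    by rewrite mulmxA -(mulmxA w^T w) wwE mul_mx_scalar -scalemxAl.
  set M := w^T *m w in MM *; move: M MM => M MM.
  rewrite mulmxBl !mulmxBr !mulmx1 mul1mx -scalemxAl -scalemxAr MM !scalerA.
  rewrite [_ * a](_ : _ = 2 / a + 2 / a); last by field.
  by rewrite scalerDl opprB addrK subrK.
rewrite linearB/= linearZ/= row_mul row1 -/e.
have -> : row 0 w^T = (w 0 0)%:M.
  by apply/rowP => i; rewrite !ord1 !mxE eqxx mulr1n.
rewrite mul_scalar_mx scalerA.
(* From |x - e|^2 = 2 (1 - x_0), the reflection sends e to e + w = x. *)
have -> : 2 / a * w 0 0 = -1.
  have -> : w 0 0 = - (a / 2) by rewrite aE !mxE !eqxx/=; field.
  by field.
by rewrite scaleN1r opprK /w addrC subrK.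
Qed.

Lemma tangent_frame_exists (R : realType) n (x : 'rV[R]_n) :
  (0 < n)%N -> sphere x ->
  exists E : 'M[R]_(n.-1, n), tangent_frame x E.
Proof.
case: n x => // m x _ x1; have [H [HH Hx]] := orthogonal_completion _ _ _ x1.
have HHE i j : \sum_k H i k * H j k = (i == j)%:R.
  have := congr1 (fun M : 'M[R]_m.+1 => M i j) HH; rewrite !mxE => <-.
  by apply: eq_bigr => k _; rewrite mxE.
exists (rowsub (lift 0) H); split; apply/matrixP => i j; rewrite !mxE.
  rewrite -(inj_eq (@lift_inj _ 0)) -HHE.
  by apply: eq_bigr => k _; rewrite !mxE.
rewrite -[RHS](HHE (lift 0 i) 0); apply: eq_bigr => k _.
by rewrite !mxE -Hx mxE.
Qed.

(** * Comparison of solutions *)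

(** The scalar core of the comparison, with S standing for h^2 + |grad h|^2 of the second solution.
    If c > 1, the two equations give f <= c^(1 - p + k - (n - q)) f with a negative exponent. *)
Lemma dilation_le1 (R : realType) (n k : nat) (p q c h S s1 s2 f : R) :
  (k <= n - 1)%N -> (0 < n)%N -> q < p -> 0 < c -> 0 < h -> 0 < S -> 0 < f ->
  s1 <= c ^+ k * s2 ->
  (c * h) `^ (1 - p) / (c ^+ 2 * S) `^ ((n%:R - q) / 2) * s1 = f ->
  h `^ (1 - p) / S `^ ((n%:R - q) / 2) * s2 = f -> c <= 1.
Proof.
move=> kn n0 qp c0 h0 S0 f0 s12 E1 E2; rewrite leNgt; apply/negP => c1.
have cE : (c ^+ 2 * S) `^ ((n%:R - q) / 2) =
    c `^ (n%:R - q) * S `^ ((n%:R - q) / 2).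
  rewrite powRM ?sqr_ge0 ?ltW// -powR_mulrn ?ltW// -powRrM; congr (_ `^ _ * _).
  by rewrite mulrC divfK.
rewrite cE powRM ?ltW// in E1.
set A := h `^ _ in E1 E2; set B := S `^ _ in E1 E2.
have A0 : 0 < A by rewrite powR_gt0.
have B0 : 0 < B by rewrite powR_gt0.
set a := c `^ (1 - p) in E1; set b := c `^ (n%:R - q) in E1.
have a0 : 0 < a by rewrite powR_gt0.
have b0 : 0 < b by rewrite powR_gt0.
(* For c > 1 this compares exponents: 1 - p + k < n - q, from k + 1 <= n and q < p. *)
have ab : a * c ^+ k < b.
  rewrite /a /b -powR_mulrn ?ltW// -powRD; last by rewrite (gt_eqF c0) implybT.
  rewrite /powR gt_eqF// ltr_expR ltr_pM2r ?ln_gt0//.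
  have : (k.+1%:R : R) <= n%:R.
    by rewrite ler_nat; case: (n) n0 kn => //= m _; rewrite subn1.
  by rewrite -natr1; move: qp; lra.
have : f <= a * c ^+ k / b * f.
  rewrite -[leLHS]E1 -E2.
  have -> : a * c ^+ k / b * (A / B * s2) = a * A / (b * B) * (c ^+ k * s2).
    by field; rewrite !gt_eqF.
  by rewrite ler_wpM2l// ltW// divr_gt0// mulr_gt0.
rewrite ler_pMl// ler_pdivlMr// mul1r => /(lt_le_trans ab).
by rewrite ltxx.
Qed.

Lemma continuous_dot_self (R : realType) n :
  continuous (fun x : 'rV[R]_n => dot x x).
Proof.
move=> x; apply/differentiable_continuous.
rewrite (_ : (fun x => dot x x) =
  \sum_i ((fun x : 'rV[R]_n => x 0 i) * (fun x : 'rV[R]_n => x 0 i))).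
  apply: differentiable_sum => i.
  by apply: differentiableM; exact: differentiable_coord.
by apply/funext => y; rewrite dotE fct_sumE.
Qed.

Lemma compact_sphere (R : realType) n : compact (@sphere R n).
Proof.
apply: bounded_closed_compact.
  exists 1; split=> // M M1 x x1.
  (* The norm here is the sup norm: each squared coordinate is at most [dot x x], which is 1. *)
  apply: le_trans (ltW M1); rewrite [leLHS]mx_normrE.
  apply: bigmax_le => // -[i j] _ /=.
  rewrite ord1 -(@ler_pXn2r _ 2)// ?nnegrE// expr1n real_normK ?num_real//.
  rewrite -(x1 : dot x x = 1) dotE (bigD1 j)//= expr2 lerDl.
  by apply: sumr_ge0 => i' _; rewrite -expr2 sqr_ge0.
have := (@continuous_closedP _ _ (fun x : 'rV[R]_n => dot x x)).1
  (continuous_dot_self R n).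
by move=> /(_ [set 1] (@closed_eq R 1)).
Qed.

Lemma max_ratio (R : realType) n (h1 h2 : 'rV[R]_n -> R) (x : 'rV[R]_n) :
  smooth_sphere h1 -> smooth_sphere h2 ->
  (forall y, sphere y -> 0 < h2 y) -> sphere x ->
  exists x0 c, [/\ sphere x0, h1 x0 = c * h2 x0 &
    forall y, sphere y -> h1 y <= c * h2 y].
Proof.
move=> s1 s2 h20 x1.
(* The ratio is formed from radial extensions, whose differentiability off the origin gives
   continuity on the sphere. *)
pose r : 'rV[R]_n -> R := radial h1 * (fun y => (radial h2 y)^-1).
have rE y : sphere y -> r y = h1 y / h2 y.
  by move=> y1; rewrite /r [LHS]/(_ * _) !radial_sphere.
have [|||x0 x0S x0max] := @EVT_max_rV R n r sphere.
- by exists x.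
- exact: compact_sphere.
- apply: continuous_in_subspaceT => y; rewrite inE => y1.
  have y0 := sphere_neq0 _ y1.
  apply: differentiable_continuous; apply: differentiableM.
    exact: (s1 [::]).
  apply: differentiableV; first exact: (s2 [::]).
  by rewrite radial_sphere// gt_eqF// h20.
rewrite inE in x0S.
exists x0, (r x0); split=> //; first by rewrite rE// divfK// gt_eqF// h20.
by move=> y y1; rewrite -ler_pdivrMr ?h20// -rE// x0max// inE.
Qed.

(** On the line x + s v, the difference of the radial extensions of h1 and c h2 is nonpositive near
    s = 0, since it is evaluated at normalised points, and vanishes at s = 0. The second derivative
    test applies, for any ambient direction v. *)
Lemma contact (R : realType) n (h1 h2 : 'rV[R]_n -> R) (x : 'rV[R]_n) c v :
  smooth_sphere h1 -> smooth_sphere h2 -> sphere x ->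
  h1 x = c * h2 x -> (forall y, sphere y -> h1 y <= c * h2 y) ->
  'D_v (radial h1) x = c * 'D_v (radial h2) x /\
  'D_v ('D_v (radial h1)) x <= c * 'D_v ('D_v (radial h2)) x.
Proof.
move=> s1 s2 x1 hx hle.
have x0 := sphere_neq0 _ x1.
have [e /= e0 he] := (nbhs_normP _ _).1 (near_neq0 _ x0).
(* For |s| < d the line stays within e of x and so avoids the origin; the summand 1 covers v = 0. *)
pose d := e / (`|v| + 1).
have v0 : 0 < `|v| + 1 by rewrite ltr_wpDl.
have d0 : 0 < d by rewrite divr_gt0.
have ne s : `|s| < d -> x + s *: v != 0.
  rewrite ltr_pdivlMr// => sd; apply: he.
  rewrite /= opprD addrA subrr add0r normrN normrZ (le_lt_trans _ sd)//.
  by rewrite ler_wpM2l// lerDl.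
pose phi s := radial h1 (x + s *: v) - c * radial h2 (x + s *: v).
pose psi s := 'D_v (radial h1) (x + s *: v) - c * 'D_v (radial h2) (x + s *: v).
pose l := 'D_v ('D_v (radial h1)) x - c * 'D_v ('D_v (radial h2)) x.
have line (G1 G2 : 'rV[R]_n -> R) (s : R) :
    derivable G1 (x + s *: v) v -> derivable G2 (x + s *: v) v ->
    is_derive s 1 (fun s => G1 (x + s *: v) - c * G2 (x + s *: v))
      ('D_v G1 (x + s *: v) - c * 'D_v G2 (x + s *: v)).
  move=> d1 d2.
  have k1 := is_derive_line _ _ _ _ _ _ _ d1.
  have k2 := is_derive_line _ _ _ _ _ _ _ d2.
  exact: (is_deriveB k1 (is_deriveZ c k2)).
have [|||] := @second_derivative_test R phi psi l d d0.
- move=> s sd; apply: line; apply: diff_derivable.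
    exact: (s1 [::] _ (ne _ sd)).
  exact: (s2 [::] _ (ne _ sd)).
- have := line ('D_v (radial h1)) ('D_v (radial h2)) 0.
  rewrite scale0r addr0; apply; apply: diff_derivable.
    exact: (s1 [:: v] _ x0).
  exact: (s2 [:: v] _ x0).
- move=> s sd; rewrite /phi scale0r addr0 !(radial_sphere _ _ x1) hx subrr.
  rewrite subr_le0.
  exact/hle/sphere_normalize/ne.
rewrite /psi /l scale0r addr0 subr_le0 => /eqP; rewrite subr_eq0 => /eqP.
by [].
Qed.

(** Rows of the frame are tangent, so the covariant Hessian becomes a congruence of an ambient one,
    from which symmetry and the quadratic form can be read. *)
Lemma hess_mxE (R : realType) n (h : 'rV[R]_n -> R) (x : 'rV[R]_n) E :
  smooth_sphere h -> sphere x -> tangent_frame x E ->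
  hess_mx h x E = E *m hessian (radial h) x *m E^T + (h x)%:M.
Proof.
move=> s x1 [_ Ex]; congr (_ + _); apply/matrixP => i j.
rewrite mxE shessE//; last first.
  have := congr1 (fun M : 'M[R]_(n.-1, 1) => M i ord0) Ex.
  rewrite dotC dotE !mxE => Ei.
  by rewrite -[RHS]Ei; apply: eq_bigr => k _; rewrite !mxE.
rewrite -row_mul [LHS]mxE [RHS]mxE; apply: eq_bigr => k _.
by rewrite !mxE.
Qed.

Lemma solution_le (R : realType) (n k : nat) (hk : (1 <= k <= n - 1)%N)
    (f : 'rV[R]_n -> R) (f_gt0 : forall x, sphere x -> 0 < f x)
    (p q : R) (hqp : q < p) (h1 h2 : 'rV[R]_n -> R)
    (sol1 : is_solution k p q f h1) (sol2 : is_solution k p q f h2) x :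
  sphere x -> h1 x <= h2 x.
Proof.
move=> x1; have [s1 p1 _ pd1 e1] := sol1; have [s2 p2 _ pd2 e2] := sol2.
have [y [c [y1 hy hle]]] := max_ratio _ _ _ _ _ s1 s2 p2 x1.
apply: le_trans (hle _ x1) _; rewrite ler_piMl ?(ltW (p2 _ x1))//.
have c0 : 0 < c by rewrite -(pmulr_lgt0 _ (p2 _ y1)) -hy p1.
have /andP[k0 kn] := hk.
have n0 : (0 < n)%N by move: (leq_trans k0 kn); rewrite subn_gt0; case: (n).
have [E Ey] := tangent_frame_exists _ _ _ n0 y1.
have U0 : open [set z : 'rV[R]_n | z != 0] := open_neq0.
have yU : [set z : 'rV[R]_n | z != 0] y := sphere_neq0 _ y1.
have hsym h : smooth_sphere h -> (hess_mx h y E)^T = hess_mx h y E.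
  move=> s; rewrite hess_mxE// linearD/= tr_scalar_mx !trmx_mul trmxK mulmxA.
  by rewrite (hessian_sym _ _ _ s U0 yU).
have Apsd : real_psdmx (hess_mx h1 y E).
  split=> [|v]; first exact: hsym.
  have [->|/eqP v0] := eqVneq v 0; first by rewrite !mul0mx mxE.
  by rewrite ltW// pd1.
have BApsd : real_psdmx (c *: hess_mx h2 y E - hess_mx h1 y E).
  split=> [|v]; first by rewrite linearB/= linearZ/= !hsym.
  (* The zeroth-order terms cancel because h1 = c h2 at y; what remains is the form of the ambient
     Hessians in direction v E. *)
  rewrite !hess_mxE// hy scalerDr opprD addrACA scale_scalar_mx subrr addr0.
  have quad h : smooth_sphere h ->
      (v *m (E *m hessian (radial h) y *m E^T) *m v^T) 0 0 =
      'D_(v *m E) ('D_(v *m E) (radial h)) y.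
    move=> s; have -> := hessianE _ (radial h) y (v *m E) (v *m E) s U0 yU.
    by rewrite trmx_mul !mulmxA.
  rewrite mulmxBr mulmxBl -scalemxAr -scalemxAl.
  have entryB (A B : 'M[R]_1) : (c *: A - B) 0 0 = c * A 0 0 - B 0 0.
    by rewrite !mxE.
  have [_] := contact _ _ _ _ _ _ (v *m E) s1 s2 y1 hy hle.
  rewrite entryB; move: (quad h1 s1) (quad h2 s2).
  generalize (hessian (radial h1) y) (hessian (radial h2) y) => H1 H2 <- <-.
  by rewrite subr_ge0.
have grad : sgrad h1 y = c *: sgrad h2 y.
  apply/rowP => j; rewrite !mxE.
  by have [] := contact _ _ _ _ _ _ (delta_mx 0 j) s1 s2 y1 hy hle.
have km : (k <= n.-1)%N by rewrite -subn1.
have := sigma_le k _ _ km Apsd BApsd.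
rewrite sigmaZ ?gt_eqF ?hsym// => sle.
(* With h1 = c h2 and proportional gradients at y, a factor c^2 comes out of h1^2 + |grad h1|^2. *)
have := e1 _ _ y1 Ey; rewrite hy grad (enormZ _ _ (ltW c0)) !exprMn -mulrDr => E1.
apply: (dilation_le1 _ _ _ _ _ _ _ _ _ _ _ kn n0 hqp c0 _ _ _ sle E1
  (e2 _ _ y1 Ey)).
- exact: p2.
- by rewrite ltr_pwDl ?sqr_ge0// exprn_gt0// p2.
- exact: f_gt0.
Qed.

Theorem theorem1p4 (R : realType) (n k : nat) (hk : (1 <= k <= n - 1)%N)
    (f : 'rV[R]_n -> R) (f_smooth : smooth_sphere f)
    (f_gt0 : forall x, sphere x -> 0 < f x)
    (p q : R) (hqp : q < p) (h1 h2 : 'rV[R]_n -> R)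
    (sol1 : is_solution k p q f h1) (sol2 : is_solution k p q f h2) :
  forall x, sphere x -> h1 x = h2 x.
Proof.
move=> x x1; apply/eqP; rewrite eq_le.
by rewrite (solution_le _ _ _ hk f f_gt0 p q hqp h1 h2)//
  (solution_le _ _ _ hk f f_gt0 p q hqp h2 h1).
Qed.
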